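(* Let $P$ be a log-concave homogeneous polynomial of degree $d$ in $n$ real variables, let $(\mathcal A,\mathcal D)$ be a perfect domain pair with respect to the piecewise multilinear extension, and let $f_1,\dots,f_n:\mathcal A\to[0,+\infty)$. Then $$\min_{A\in\mathcal A}\frac{P(f_1(A),\dots,f_n(A))}{(f_1(A)+\dots+f_n(A))^d}=\inf_{x\in\mathcal D}\frac{P(f_1^M(x),\dots,f_n^M(x))}{(f_1^M(x)+\dots+f_n^M(x))^d},$$ where both sides are taken over those $A\in\mathcal A$, respectively $x\in\mathcal D$, for which the denominator is nonzero.
   Context: A $d$-homogeneous polynomial $P$ in $n$ real variables is log-concave if $P>0$ on $(0,\infty)^n$ and $\log P$ is concave on $(0,\infty)^n$. Let $V$ be a finite set, $N=\#V$, $k\ge1$. For $u\in\mathbb R^N$ and $t\in\mathbb R$ put $V^t(u)=\{j\in V:u_j>t\}$. For a nonempty $\mathcal A\subset(\mathcal P(V)\setminus\{\varnothing\})^k$ let $$\mathcal D(\mathcal A)=\{(x^1,\dots,x^k)\in([0,\infty)^N\setminus\{0\})^k:\ (V^{t_1}(x^1),\dots,V^{t_k}(x^k))\in\mathcal A\ \ \forall\,0\le t_i<\max x^i,\ i=1,\dots,k\},$$ and for $\mathcal D\subset([0,\infty)^N\setminus\{0\})^k$ let $$\mathcal A(\mathcal D)=\{(V^{t_1}(x^1),\dots,V^{t_k}(x^k)):\ (x^1,\dots,x^k)\in\mathcal D,\ 0\le t_i<\max x^i\}.$$ $(\mathcal A,\mathcal D)$ is a perfect domain pair if $\mathcal A=\mathcal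 A(\mathcal D)$ and $\mathcal D=\mathcal D(\mathcal A)$. For $f:\mathcal A\to\mathbb R$ the piecewise multilinear extension on $\mathcal D(\mathcal A)$ is $$f^M(x^1,\dots,x^k)=\int_0^{\max x^k}\!\!\cdots\int_0^{\max x^1} f(V^{t_1}(x^1),\dots,V^{t_k}(x^k))\,dt_1\cdots dt_k.$$ *)

(* Defs.v *)
From mathcomp Require Import all_boot all_order all_algebra.
(* The notations of mpoly clash with those of MathComp-Analysis. *)
From mathcomp Require Import -(notations) mpoly.
From mathcomp Require Import all_classical all_reals all_analysis.

Set Implicit Arguments.
Unset Strict Implicit.
Unset Printing Implicit Defensive.

Import Order.TTheory GRing.Theory Num.Theory.
Import numFieldNormedType.Exports.

Local Open Scope classical_set_scope.
Local Open Scope ring_scope.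

Definition positive_orthant {R : realType} (n : nat) : set 'rV[R]_n :=
  [set y | forall i, 0 < y 0 i].

(* Concavity of log P is convexity of - log P. *)
Definition log_concave {R : realType} {n : nat} (P : mpoly n R) : Prop :=
  (forall y : 'rV[R]_n, positive_orthant y -> 0 < meval (y 0) P) /\
  convex_function (E := 'rV[R]_n) (@positive_orthant R n)
    (fun y : 'rV[R]_n => - ln (meval (y 0) P)).

Section MultilinearExtension.
Context {R : realType} {V : finType} {k : nat}.
Implicit Types (u : {ffun V -> R}) (x : {ffun 'I_k -> {ffun V -> R}}).
Implicit Types (A : {ffun 'I_k -> {set V}}) (t : 'I_k -> R).

Definition level_set u (r : R) : {set V} := [set j | r < u j]%SET.

Definition level_sets x t : {ffun 'I_k -> {set V}} :=
  [ffun i => level_set (x i) (t i)].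

(* Used only for u >= 0, where the default value 0 does not affect the
   maximum. *)
Definition vmax u : R := \big[Num.max/0]_(j : V) u j.

Definition is_level x t : Prop := forall i, 0 <= t i < vmax (x i).

Definition nonneg_nonzero : set {ffun 'I_k -> {ffun V -> R}} :=
  [set x : {ffun 'I_k -> {ffun V -> R}} | forall i, (forall j, 0 <= x i j) /\ x i != 0].

Definition domain_of (AA : {set {ffun 'I_k -> {set V}}}) :
    set {ffun 'I_k -> {ffun V -> R}} :=
  [set x | nonneg_nonzero x /\ forall t, is_level x t -> level_sets x t \in AA].

Definition family_of (D : set {ffun 'I_k -> {ffun V -> R}}) :
    set {ffun 'I_k -> {set V}} :=
  [set A | exists x t, [/\ D x, is_level x t & A = level_sets x t]].

Definition perfect_domain_pair (AA : {set {ffun 'I_k -> {set V}}})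
    (D : set {ffun 'I_k -> {ffun V -> R}}) : Prop :=
  [/\ AA != finset.set0,
      forall A, A \in AA -> forall i, A i != finset.set0,
      D `<=` nonneg_nonzero,
      [set` AA] = family_of D
    & D = domain_of AA].

End MultilinearExtension.

(* int_0^(b_k) ... int_0^(b_1) F (t_1, ..., t_k) dt_1 ... dt_k, the coordinate
   of index ord0 being integrated innermost. *)
Fixpoint iterated_integral {R : realType} {k : nat} :
    ('I_k -> R) -> (('I_k -> R) -> R) -> R :=
  match k with
  | 0 => fun _ F => F (fun=> 0)
  | k'.+1 => fun b F =>
      iterated_integral (fun i : 'I_k' => b (lift ord0 i))
        (fun t => \int[lebesgue_measure]_(s in `[0, b ord0[)
                    F (fun i => oapp t s (unlift ord0 i)))
  end.

(* A function on a family AA is represented by a total function f; since the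
   intervals of integration are half-open, only its values on AA are used when
   x belongs to domain_of AA. *)
Definition multilinear_extension {R : realType} {V : finType} {k : nat}
    (f : {ffun 'I_k -> {set V}} -> R) (x : {ffun 'I_k -> {ffun V -> R}}) : R :=
  iterated_integral (fun i => vmax (x i)) (fun t => f (level_sets x t)).

(* Main.v *)
Require Import Defs.
From mathcomp Require Import all_boot all_order all_algebra.
From mathcomp Require Import -(notations) mpoly.
From mathcomp Require Import all_classical all_reals all_analysis.

(** Fix a real [m].  For nonnegative [y] with a nonzero denominator, the
    inequality [P y / (\sum_i y i) ^+ d >= m] says that [y] lies in the set
    [ratio_cone P d m], where it is written without a division.  Everything rests on this set being a convex cone
    ([convex_cone_ratio]): by homogeneity it is stable under nonnegative
    scaling and is determined by its slice [\sum_i y i = 1], and on that slice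
    it is a superlevel set of [P], that is, of the concave function [log P],
    hence convex.  Log-concavity is only known on
    the open orthant; the closed orthant is reached by shifting all coordinates
    by [e > 0] and letting [e] tend to [0].

    The extension [f^M(x)] is an iterated integral of a function with finitely
    many values, hence a nonnegative combination of vectors [f(A)] where [A]
    runs through the level sets of [x], and these belong to the family.  So if
    the ratio is at least [m] on the family, all the vectors [f(A)] lie in the
    cone, therefore so does [f^M(x)] ([iterated_integral_cone]), and the ratio
    is at least [m] on the domain.

    Conversely every value of the ratio on the family is one of its values on
    the domain: the tuple of indicator functions of [A] lies in the domain and
    all its level sets equal [A], so the extension takes the value [f(A)]
    there. *)

Set Implicit Arguments.
Unset Strict Implicit.
Unset Printing Implicit Defensive.

Import Order.TTheory GRing.Theory Num.Theory.
Import numFieldNormedType.Exports.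

Local Open Scope classical_set_scope.
Local Open Scope ring_scope.

(** * Polynomials near the boundary of the orthant *)

(** Restricted to the line through [y] of direction [(1, ..., 1)], [P] is a
    univariate polynomial, which makes it continuous there. *)
Lemma meval_shiftE (R : realType) n (P : mpoly n R) (y : 'I_n -> R) :
  exists p : {poly R}, forall e, meval (fun i => y i + e) P = p.[e].
Proof.
exists (\sum_(m <- msupp P)
  (mcoeff m P)%:P * \prod_i ('X + (y i)%:P) ^+ m i) => e.
rewrite mevalE horner_sum; apply: eq_bigr => m _.
rewrite hornerM hornerC horner_prod; congr (_ * _); apply: eq_bigr => i _.
by rewrite horner_exp hornerD hornerX hornerC addrC.
Qed.

Lemma meval_shift_cvg (R : realType) n (P : mpoly n R) (y : 'I_n -> R) :
  (meval (fun i => y i + e) P @[e --> 0^'+] --> meval y P).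
Proof.
have [p pE] := meval_shiftE P y.
have -> : meval y P = p.[0].
  by rewrite -pE; apply: meval_eq => i; rewrite addr0.
under eq_fun do rewrite pE.
by apply: cvg_at_right_filter; apply: continuous_horner.
Qed.

(** * The convex cone of a lower bound on the ratio *)

Lemma meval_homog (R : realType) n d (P : mpoly n R) (c : R) (y : 'I_n -> R) :
  P \is ishomog1 d mdeg -> meval (fun i => c * y i) P = c ^+ d * meval y P.
Proof.
move=> /dhomogP homP; rewrite !mevalE mulr_sumr; apply: eq_big_seq => m mP.
under eq_bigr do rewrite exprMn.
rewrite big_split /= prodrXr -mdegE mulrCA; congr (_ ^+ _ * _).
exact: homP.
Qed.

(** Concavity of the logarithm bounds [ln P] at the barycenter below by the
    barycenter of two numbers that are at least [ln m]. *)
Lemma log_concave_quasiconcave_pos (R : realType) n (P : mpoly n R) (t m : R)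
    (y z : 'I_n -> R) :
  log_concave P -> 0 <= t <= 1 ->
  (forall i, 0 < y i) -> (forall i, 0 < z i) ->
  m <= meval y P -> m <= meval z P ->
  m <= meval (fun i => t * y i + (1 - t) * z i) P.
Proof.
move=> [P_gt0 P_conc] /andP[t0 t1] y0 z0 my mz.
pose Y : 'rV[R]_n := \row_i y i; pose Z : 'rV[R]_n := \row_i z i.
have YE : Y 0 = y by apply/funext => i; rewrite mxE.
have ZE : Z 0 = z by apply/funext => i; rewrite mxE.
have Yp : positive_orthant Y by move=> i; rewrite YE.
have Zp : positive_orthant Z by move=> i; rewrite ZE.
pose W : 'rV[R]_n := t *: Y + (1 - t) *: Z.
have WE : W 0 = (fun i => t * y i + (1 - t) * z i).
  by apply/funext => i; rewrite !mxE.
have Wp : positive_orthant W.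
  move=> i; rewrite WE.
  have [->|tn0] := eqVneq t 0; first by rewrite mul0r add0r subr0 mul1r.
  rewrite ltr_wpDr ?mulr_ge0 ?subr_ge0 ?(ltW (z0 _)) // mulr_gt0 //.
  by rewrite lt_neqAle eq_sym tn0.
have := P_conc (Itv01 t0 t1) Y Z (mem_set Yp) (mem_set Zp).
rewrite /conv /=.
change (- ln (meval (W 0) P) <= t * - ln (meval (Y 0) P)
  + (1 - t) * - ln (meval (Z 0) P) ->
  m <= meval (fun i => t * y i + (1 - t) * z i) P).
have := P_gt0 _ Wp; have := P_gt0 _ Yp; have := P_gt0 _ Zp.
rewrite YE ZE WE => Pz Py Pw.
(* A nonpositive bound holds because [P] is positive on the orthant; only a
   positive one has a meaningful logarithm. *)
have [m0|m0 _] := ltP 0 m; last by rewrite (le_trans m0) // ltW.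
rewrite !mulrN -opprD lerN2 => Hln; rewrite -ler_ln ?posrE //.
apply: le_trans Hln.
have -> : ln m = t * ln m + (1 - t) * ln m by rewrite -mulrDl addrC subrK mul1r.
by rewrite lerD // ler_wpM2l ?subr_ge0 // ler_ln ?posrE.
Qed.

(** Both points are shifted into the open orthant by the same [e > 0], which
    shifts their barycenter by [e] as well; then [e] tends to [0].  The shifted
    points need not satisfy the bound [m], but they satisfy [m - r] for small
    [e], whatever [r > 0]. *)
Lemma log_concave_quasiconcave (R : realType) n (P : mpoly n R) (t m : R)
    (y z : 'I_n -> R) :
  log_concave P -> 0 <= t <= 1 ->
  (forall i, 0 <= y i) -> (forall i, 0 <= z i) ->
  m <= meval y P -> m <= meval z P ->
  m <= meval (fun i => t * y i + (1 - t) * z i) P.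
Proof.
move=> lcP t01 y0 z0 my mz; apply/ler_addgt0Pr => r r0.
rewrite -lerBlDr.
have cvgw := @meval_shift_cvg _ _ P (fun i => t * y i + (1 - t) * z i).
apply: (@closed_cvg _ _ (0^'+) _ _ _ (@closed_ge R (m - r)) _ _ cvgw) => /=.
have near_ge (v : 'I_n -> R) : m <= meval v P ->
    \forall e \near 0^'+, m - r <= meval (fun i => v i + e) P.
  move=> mv; apply: (cvgr_ge _ (@meval_shift_cvg _ _ P v)).
  by rewrite (lt_le_trans _ mv) // gtrBl.
near=> e.
have e0 : 0 < e by near: e; exact: nbhs_right_gt.
rewrite (_ : (fun i => _) =
    fun i => t * (y i + e) + (1 - t) * (z i + e)); last first.
  by apply/funext => i; rewrite !mulrDr addrACA -mulrDl [t + _]addrC subrK mul1r.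
apply: log_concave_quasiconcave_pos => // [i|i||]; rewrite ?ltr_wpDl //.
- by near: e; exact: near_ge.
- by near: e; exact: near_ge.
Unshelve. all: by end_near. Qed.

(** With nonemptiness instead of [0] as a member, the case [d = 0] needs no
    special treatment: [0] is obtained by scaling a member by [0]. *)
Definition convex_cone (R : realType) n (C : set ('I_n -> R)) :=
  [/\ C !=set0,
      forall y z, C y -> C z -> C (fun i => y i + z i)
    & forall c y, 0 <= c -> C y -> C (fun i => c * y i)].

Lemma convex_cone_sum (R : realType) n (C : set ('I_n -> R)) (I : Type)
    (r : seq I) (w : I -> R) (v : I -> 'I_n -> R) :
  convex_cone C -> (forall a, 0 <= w a) -> (forall a, w a != 0 -> C (v a)) ->
  C (fun i => \sum_(a <- r) w a * v a i).
Proof.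
move=> [[y0 Cy0] addC scaleC] w0 Cv.
have C0 : C (fun=> 0).
  rewrite (_ : (fun=> 0) = fun i => 0 * y0 i); first exact: scaleC.
  by apply/funext => i; rewrite mul0r.
elim: r => [|a r IHr].
  by under eq_fun do rewrite big_nil.
under eq_fun do rewrite big_cons.
apply: (addC (fun i => w a * v a i)) => //.
have [->|wa] := eqVneq (w a) 0; last by apply: scaleC => //; apply: Cv.
by under eq_fun do rewrite mul0r.
Qed.

(** Clearing the denominator keeps the vectors with zero coordinate sum, so that
    the set is closed under all nonnegative scalings. *)
Definition ratio_cone (R : realType) n (P : mpoly n R) d (m : R) :
    set ('I_n -> R) :=
  [set y | (forall i, 0 <= y i) /\ m * (\sum_i y i) ^+ d <= meval y P].

(** After division by its coordinate sum, each of [y] and [z] satisfies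
    [P >= m]; the normalization of [y + z] is a barycenter of these two points,
    so quasiconcavity applies, and homogeneity undoes the normalization. *)
Lemma convex_cone_ratio (R : realType) n d (P : mpoly n R) (m : R) :
  P \is ishomog1 d mdeg -> log_concave P ->
  ratio_cone P d m !=set0 -> convex_cone (ratio_cone P d m).
Proof.
move=> homP lcP C0.
have scaleC c y : 0 <= c -> ratio_cone P d m y ->
    ratio_cone P d m (fun i => c * y i).
  move=> c0 [y0 my]; split=> [i|]; first by rewrite mulr_ge0.
  by rewrite (meval_homog _ _ homP) -mulr_sumr exprMn mulrCA ler_wpM2l ?exprn_ge0.
split=> // y z [y0 my] [z0 mz]; split=> [i|]; first by rewrite addr_ge0.
rewrite big_split /=; set sy := \sum_i y i in my *; set sz := \sum_i z i in mz *.
have sy0 : 0 <= sy by rewrite sumr_ge0.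
have sz0 : 0 <= sz by rewrite sumr_ge0.
have sum0 (v : 'I_n -> R) : (forall i, 0 <= v i) -> \sum_i v i = 0 ->
    forall i, v i = 0.
  move=> v0 /eqP; rewrite psumr_eq0 // => /allP + i.
  by move=> /(_ i (mem_index_enum _)) /eqP.
(* A vector with zero coordinate sum cannot be normalized, but it is zero. *)
have [sy_eq0|syn0] := eqVneq sy 0.
  rewrite sy_eq0 add0r (_ : (fun i => _) = z) //.
  by apply/funext => i; rewrite (sum0 y) ?add0r.
have [sz_eq0|szn0] := eqVneq sz 0.
  rewrite sz_eq0 addr0 (_ : (fun i => _) = y) //.
  by apply/funext => i; rewrite (sum0 z) ?addr0.
have syp : 0 < sy by rewrite lt_neqAle eq_sym syn0.
have szp : 0 < sz by rewrite lt_neqAle eq_sym szn0.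
have normalized v s : 0 < s -> m * s ^+ d <= meval v P ->
    m <= meval (fun i => s^-1 * v i) P.
  move=> s0 mv; rewrite (meval_homog _ _ homP) exprVn mulrC.
  by rewrite ler_pdivlMr ?exprn_gt0.
set t := sy / (sy + sz).
have s_neq0 : sy + sz != 0 by rewrite gt_eqF ?addr_gt0.
have tE : 1 - t = sz / (sy + sz).
  by rewrite -(divff s_neq0) -mulrBl addrAC subrr add0r.
have t01 : 0 <= t <= 1.
  by rewrite -[t <= 1]subr_ge0 tE !divr_ge0 ?addr_ge0.
have := log_concave_quasiconcave lcP t01 _ _
  (normalized _ _ syp my) (normalized _ _ szp mz).
rewrite tE (_ : (fun i => t * _ + _) =
    fun i => (sy + sz)^-1 * (y i + z i)); last first.
  apply/funext => i; rewrite /t !mulrA [sy / _ / _]mulrAC mulfV // mul1r.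
  by rewrite [sz / _ / _]mulrAC mulfV // mul1r mulrDr.
rewrite (meval_homog _ _ homP) exprVn mulrC ler_pdivlMr ?exprn_gt0 ?addr_gt0 //.
by apply=> i; rewrite mulr_ge0 ?invr_ge0.
Qed.

(** * Iterated integrals of functions with finitely many values *)

Lemma Rintegral_finite_range d (S : measurableType d) (R : realType)
    (mu : {measure set S -> \bar R}) (T : finType) (D : set S)
    (l : S -> T) (g : T -> R) :
  measurable D -> (mu D < +oo)%E -> (forall a, measurable [set s | l s = a]) ->
  \int[mu]_(s in D) g (l s) =
  \sum_a fine (mu (D `&` [set s | l s = a])) * g a.
Proof.
move=> mD finD ml.
pose E a := D `&` [set s | l s = a].
have mE a : measurable (E a) by exact: measurableI.
have DE : D = \big[setU/set0]_(a <- index_enum T) E a.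
  rewrite -bigcup_seq; apply/seteqP; split=> [s Ds|s [a _ []] //].
  by exists (l s) => //=; rewrite mem_index_enum.
have finE a : mu (E a) \is a fin_num.
  rewrite ge0_fin_numE //; apply: le_lt_trans finD.
  by apply: le_measure; rewrite ?inE //; exact: subIsetl.
have intE a :
    (\int[mu]_(s in E a) (g (l s))%:E = (fine (mu (E a)) * g a)%:E)%E.
  rewrite (@eq_integral _ _ _ _ _ (cst (g a)%:E)) => [|s]; last first.
    by move=> /set_mem[_ /= ->].
  by rewrite integral_cst // EFinM fineK // muleC.
have glE : g \o l = fun s => \sum_a g a * \1_[set s | l s = a] s.
  apply/funext => s /=; rewrite (bigD1 (l s)) //= big1 ?addr0 => [|a al].
    by rewrite indicE mem_set ?mulr1.
  by rewrite indicE memNset ?mulr0 //= => sa; rewrite sa eqxx in al.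
have mgl A : measurable_fun A (g \o l).
  rewrite glE; apply: measurable_sum => a.
  by apply: measurable_realfun.measurable_funM => //; exact: measurable_indic.
rewrite /Rintegral {1}DE (@integral_bigsetU_EFin _ _ _ mu _ E (g \o l)) //.
- by under eq_bigr do rewrite intE; rewrite sumEFin.
- exact: index_enum_uniq.
- by move=> a a' _ _ [s [[_ <-] [_ <-]]].
- exact/measurable_realfun.measurable_EFinP.
Qed.

Lemma iterated_integral_cst (R : realType) k (b : 'I_k -> R)
    (F : ('I_k -> R) -> R) (c : R) :
  (forall i, b i = 1) ->
  (forall t, (forall i, 0 <= t i < b i) -> F t = c) ->
  iterated_integral b F = c.
Proof.
elim: k b F => [|k IHk] b F b1 Fc /=; first by apply: Fc => -[].
apply: IHk => // t tb.
rewrite (@eq_Rintegral _ _ _ _ _ (cst c)) => [|s /set_mem /= sb].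
  rewrite Rintegral_cst // [X in fine X](_ : _ = 1%E) ?mulr1 // b1.
  by apply: etrans (lebesgue_measure_itv _) _; rewrite /= lte_fin ltr01 oppr0 adde0.
by apply: Fc => i; case: unliftP => [j ->|->] /=.
Qed.

(** The integral of a function of finitely many values is a combination of these
    values with nonnegative weights, and only values that are attained have a
    nonzero weight.  Having [F] depend on [t] through labels [l j (t j)] in a
    finite type keeps this form after the innermost integration, which makes
    the induction on the number of variables possible. *)
Lemma iterated_integral_cone (R : realType) n (C : set ('I_n -> R))
    (T : finType) k (b : 'I_k -> R) (l : 'I_k -> R -> T)
    (F : 'I_n -> {ffun 'I_k -> T} -> R) :
  convex_cone C -> (forall i a, measurable [set s | l i s = a]) ->
  (forall t, (forall i, 0 <= t i < b i) -> C (fun i => F i [ffun j => l j (t j)])) ->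
  C (fun i => iterated_integral b (fun t => F i [ffun j => l j (t j)])).
Proof.
move=> coneC; elim: k b l F => [|k IHk] b l F ml CF /=.
  by apply: CF => -[].
pose scons (a : T) (A : {ffun 'I_k -> T}) : {ffun 'I_k.+1 -> T} :=
  [ffun j => oapp A a (unlift ord0 j)].
pose w a := fine (lebesgue_measure
  ([set` `[0, b ord0[] `&` [set s | l ord0 s = a])).
have sconsE t s : [ffun j => l j (oapp t s (unlift ord0 j))]
    = scons (l ord0 s) [ffun j => l (lift ord0 j) (t j)].
  by apply/ffunP => j; rewrite !ffunE; case: unliftP => [j' ->|->] /=;
    rewrite ?ffunE.
have integralE i t : \int[lebesgue_measure]_(s in `[0, b ord0[)
      F i [ffun j => l j (oapp t s (unlift ord0 j))] =
    (fun A => \sum_a w a * F i (scons a A)) [ffun j => l (lift ord0 j) (t j)].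
  under eq_Rintegral do rewrite sconsE.
  apply: (Rintegral_finite_range (fun a => F i (scons a _))) => //; last exact: ml.
  apply: (@eq_ind_r _ _ (fun e => (e < +oo)%E) _ _ (lebesgue_measure_itv _)).
  by case: ifP => _; rewrite /= ltry.
rewrite (_ : (fun i => _) = fun i => iterated_integral
    (fun j => b (lift ord0 j))
    (fun t => (fun A => \sum_a w a * F i (scons a A))
                [ffun j => l (lift ord0 j) (t j)])); last first.
  by apply/funext => i; congr iterated_integral; apply/funext => t.
apply: (IHk _ (fun j => l (lift ord0 j))
  (fun i A => \sum_a w a * F i (scons a A))) => // t tb.
apply: convex_cone_sum => // [a|a wa]; first exact: fine_ge0.
have [/= s [sb lsa]] : [set` `[0, b ord0[] `&` [set s | l ord0 s = a] !=set0.
  apply/set0P; apply: contra_neq wa => E.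
  by rewrite /w E measure0.
rewrite -lsa -sconsE; apply: CF => i.
by case: unliftP => [j ->|->] /=.
Qed.

(** * Level sets and indicator functions *)

Lemma measurable_level_set (R : realType) (V : finType) (u : {ffun V -> R})
    (A : {set V}) :
  measurable [set s | level_set u s = A].
Proof.
rewrite (_ : [set s | _] =
    \big[setI/setT]_(j <- index_enum V) [set s | (s < u j) = (j \in A)]).
  apply: bigsetI_measurable => j _.
  have lt_itv : [set s | s < u j] = [set` `]-oo, u j[].
    by apply/seteqP; split=> s /=; rewrite in_itv.
  case: (j \in A); first by rewrite lt_itv.
  rewrite (_ : [set s | _] = ~` [set s | s < u j]).
    by rewrite lt_itv; apply: measurableC.
  by apply/seteqP; split=> s /=; [move=> -> | move/negP/negbTE].
rewrite -bigcap_seq; apply/seteqP; split=> [s /= <- j _ /=|s /= As].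
  by rewrite inE.
by apply/setP => j; rewrite inE As //= mem_index_enum.
Qed.

Definition set_indicators (R : realType) (V : finType) k
    (A : {ffun 'I_k -> {set V}}) : {ffun 'I_k -> {ffun V -> R}} :=
  [ffun i => [ffun j => (j \in A i)%:R]].

Lemma vmax_set_indicators (R : realType) (V : finType) k
    (A : {ffun 'I_k -> {set V}}) i :
  A i != finset.set0 -> vmax (set_indicators R A i) = 1.
Proof.
case/set0Pn => j jA; apply/le_anti/andP; split.
  by apply: bigmax_le => // j' _; rewrite !ffunE; case: (_ \in _).
by apply: le_trans (le_bigmax _ _ j); rewrite !ffunE jA.
Qed.

Lemma level_sets_set_indicators (R : realType) (V : finType) k
    (A : {ffun 'I_k -> {set V}}) (t : 'I_k -> R) :
  (forall i, 0 <= t i < 1) -> level_sets (set_indicators R A) t = A.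
Proof.
move=> t01; apply/ffunP => i; rewrite ffunE; apply/setP => j.
have /andP[t0 t1] := t01 i.
by rewrite inE !ffunE; case: (j \in A i); rewrite // ltNge t0.
Qed.

Lemma domain_of_set_indicators (R : realType) (V : finType) k
    (AA : {set {ffun 'I_k -> {set V}}}) (A : {ffun 'I_k -> {set V}}) :
  (forall i, A i != finset.set0) -> A \in AA ->
  domain_of AA (set_indicators R A).
Proof.
move=> An0 AAA; split=> [i|t tlev].
  split=> [j|]; first by rewrite !ffunE ler0n.
  have /set0Pn[j jA] := An0 i.
  by apply/eqP => /ffunP/(_ j)/eqP; rewrite !ffunE jA oner_eq0.
rewrite level_sets_set_indicators // => i.
by rewrite -(vmax_set_indicators R (An0 i)).
Qed.

Lemma multilinear_extension_set_indicators (R : realType) (V : finType) k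
    (f : {ffun 'I_k -> {set V}} -> R) (A : {ffun 'I_k -> {set V}}) :
  (forall i, A i != finset.set0) ->
  multilinear_extension f (set_indicators R A) = f A.
Proof.
move=> An0; have v1 i := vmax_set_indicators R (An0 i).
apply: iterated_integral_cst => // t tb; congr f.
by apply: level_sets_set_indicators => i; rewrite -(v1 i).
Qed.

(** * The equality of the two bounds *)

(* Both sides are extended reals, equal to +oo when every denominator
   vanishes. *)
Theorem proposition1p1 (R : realType) (n d k : nat) (V : finType)
    (P : mpoly n R)
    (hom_P : P \is ishomog1 d mdeg)
    (logconc_P : log_concave P)
    (k_ge1 : (1 <= k)%N)
    (AA : {set {ffun 'I_k -> {set V}}})
    (D : set {ffun 'I_k -> {ffun V -> R}})
    (AD_perfect : perfect_domain_pair AA D)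
    (f : 'I_n -> {ffun 'I_k -> {set V}} -> R)
    (f_ge0 : forall i A, A \in AA -> 0 <= f i A) :
  \big[mine/+oo%E]_(A in AA | (\sum_i f i A) ^+ d != 0)
      (meval (fun i => f i A) P / (\sum_i f i A) ^+ d)%:E
  = ereal_inf
      [set (meval (fun i => multilinear_extension (f i) x) P
            / (\sum_i multilinear_extension (f i) x) ^+ d)%:E
      | x in [set x | D x /\ (\sum_i multilinear_extension (f i) x) ^+ d != 0]].
Proof.
have [/set0Pn[A0 A0AA] An0 _ _ DE] := AD_perfect.
apply/le_anti/andP; split; last first.
  apply: le_bigmin => [|A /andP[AAA sA]]; first exact: leey.
  apply: ereal_inf_lbound.
  exists (set_indicators R A); last first.
    under eq_fun do rewrite (multilinear_extension_set_indicators _ (An0 _ AAA)).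
    by under eq_bigr do rewrite (multilinear_extension_set_indicators _ (An0 _ AAA)).
  split; first by rewrite DE; exact: domain_of_set_indicators (An0 _ AAA) _.
  by under eq_bigr do rewrite (multilinear_extension_set_indicators _ (An0 _ AAA)).
apply/ereal_infP => _ [x [Dx sx_neq0] <-].
set s := \sum_i multilinear_extension (f i) x in sx_neq0 *.
set lhs := \big[_/_]_(_ in _ | _) _.
(* It is enough to compare real lower bounds: a left-hand side equal to [+oo]
   would make every real number a lower bound of a real ratio. *)
suff real_below m : (m%:E <= lhs)%E ->
    m <= meval (fun i => multilinear_extension (f i) x) P / s ^+ d.
  case: lhs real_below => [r rb|rb|_]; last exact: leNye.
    by rewrite lee_fin rb.
  set q := _ / _ in rb *.
  by have := rb (q + 1) (leey _); rewrite gerDl ler10.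
move=> m_le.
have coneA A : A \in AA -> ratio_cone P d m (fun i => f i A).
  move=> AAA; split=> [i|]; first exact: f_ge0.
  have sA0 : 0 <= \sum_i f i A by apply: sumr_ge0 => i _; exact: f_ge0.
  have [sAd0|sAd] := eqVneq ((\sum_i f i A) ^+ d) 0.
    (* Here [d > 0] and [f(A) = 0], where both members of the inequality
       vanish. *)
    move/eqP: (sAd0); rewrite expf_eq0 => /andP[d_gt0 /eqP sA].
    rewrite sAd0 mulr0.
    have fA i : f i A = 0.
      move/eqP: sA; rewrite psumr_eq0 => [/allP/(_ i (mem_index_enum _))/eqP //|].
      by move=> j _; exact: f_ge0.
    rewrite (@meval_eq _ _ _ (fun i => 0 * f i A)) => [|i]; last by rewrite mul0r.
    by rewrite (meval_homog _ _ hom_P) expr0n eqn0Ngt d_gt0 mul0r.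
  rewrite -ler_pdivlMr; last by rewrite lt_neqAle eq_sym sAd exprn_ge0.
  rewrite -lee_fin; apply: le_trans m_le _.
  by apply: (bigmin_inf A); rewrite ?AAA.
have coneC : convex_cone (ratio_cone P d m).
  by apply: convex_cone_ratio => //; exists (fun i => f i A0); exact: coneA.
have [y_ge0 my] : ratio_cone P d m (fun i => multilinear_extension (f i) x).
  have := @iterated_integral_cone _ _ _ _ _ (fun i => vmax (x i))
    (fun i => level_set (x i)) f coneC _ _.
  apply=> [i A|t tx]; first exact: measurable_level_set.
  apply: coneA; move: Dx; rewrite DE => -[_]; exact.
rewrite ler_pdivlMr // lt_neqAle eq_sym sx_neq0 exprn_ge0 // sumr_ge0 //.
Qed.
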